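(* Let $n\ge 2$ and $k\ge 0$. The number of Boolean intervals of rank $k$ in the right weak order of the Coxeter group of type $D_n$ is $$2^{n-k-1}\,n!\left(\binom{n-k}{k-2}+\binom{n-k-1}{k-1}+\binom{n-k}{k}\right).$$
   Context: Type $D_n$: generators $s_1,\ldots,s_{n-2},s_{n-1},s'_{n-1}$ with $m(s_i,s_{i+1})=3$ for $1\le i\le n-2$, $m(s_{n-2},s'_{n-1})=3$, all other distinct pairs commuting; it has order $2^{n-1}n!$. Right weak order: $u\le w$ iff $\ell(w)=\ell(u)+\ell(u^{-1}w)$. A Boolean interval of rank $k$ is an interval isomorphic to the lattice of subsets of a $k$-element set. Binomial coefficients $\binom{a}{b}$ are $0$ unless $0\le b\le a$. *)

(* Defs.v *)
From HB Require Import structures.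
From mathcomp Require Import all_boot all_order all_fingroup all_algebra.

Set Implicit Arguments.
Unset Strict Implicit.
Unset Printing Implicit Defensive.

Section CoxeterSystem.
Variables (I : finType) (W : finGroupType).
Local Open Scope group_scope.

Definition coxeter_relations (H : groupType) (m : I -> I -> nat) (t : I -> H) :
    Prop :=
  forall i j, (t i * t j) ^+ m i j = 1.

(* W = < s_i | (s_i s_j)^(m i j) = 1 >, as the universal property of the
   presentation, against all groups (finite or not). The diagonal entries of m
   are meant to be 1, and all entries to be finite and nonzero. *)
Definition coxeter_system (m : I -> I -> nat) (s : I -> W) : Prop :=
  [/\ <<[set s i | i : I]>> = [set: W],
      coxeter_relations m s
    & forall (H : groupType) (t : I -> H), coxeter_relations m t ->
        exists f : {multiplicative W -> H}, forall i, f (s i) = t i].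

(* When s generates W, the partial products of a shortest word are pairwise
   distinct, so its length is < #|W| and the search always succeeds. *)
Definition cox_length (s : I -> W) (w : W) : nat :=
  find (fun l => [exists t : l.-tuple I, \prod_(i <- t) s i == w])
       (iota 0 #|W|).

Definition right_weak (s : I -> W) : rel W :=
  fun u w => cox_length s w == (cox_length s u + cox_length s (u^-1 * w))%N.

End CoxeterSystem.

Section BooleanInterval.
Variables (T : finType) (le : rel T).

Definition interval (u v : T) : {set T} := [set x | le u x && le x v].

Definition is_interval (A : {set T}) : bool :=
  [exists u, exists v, le u v && (A == interval u v)].

(* The order embedding f is injective, since inclusion is antisymmetric. *)
Definition iso_subset_lattice (k : nat) (A : {set T}) : bool :=
  [exists f : {ffun {set 'I_k} -> T},
     ([set f X | X : {set 'I_k}] == A)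
     && [forall X, forall Y, le (f X) (f Y) == (X \subset Y)]].

Definition boolean_intervals (k : nat) : {set {set T}} :=
  [set A | is_interval A && iso_subset_lattice k A].

End BooleanInterval.

(* Some i, for i : 'I_n.-1, stands for s_(i+1) (so s_1, ..., s_(n-1)), and None
   for s'_(n-1). The generator s_(n-2), adjacent to None, is Some i with
   i + 3 = n; there is none when n = 2. *)
Definition coxeter_mx_D (n : nat) (x y : option 'I_n.-1) : nat :=
  match x, y with
  | Some i, Some j =>
      if i == j then 1 else if (i.+1 == j) || (j.+1 == i) then 3 else 2
  | Some i, None | None, Some i => if i.+3 == n then 3 else 2
  | None, None => 1
  end.

(* 0 unless 0 <= b <= a, also for negative a or b. *)
Definition binz (a b : int) : nat :=
  match a, b with
  | Posz a', Posz b' => 'C(a', b')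
  | _, _ => 0
  end.

(* Main.v *)
(* The reflection cocycle [N w] (the set of left inversions of [w], obtained from the
   universal property by letting [W] act on [W * bool]) turns the weak order into
   inclusion: [l w = #|N w|] and [u <= w] iff [N u \subset N w]. A Boolean interval of
   rank [k] is then [u, u w_J] for a unique pair of a set [J] of [k] commuting
   generators and an element [u] of minimal length in its coset modulo <J>; there are
   |W| / 2^k such [u] for each [J]. In type D the order of [W] comes from the chain of
   subgroups generated by the tails of the diagram, whose indices are read off the
   action on signed points, and the sets [J] are the independent sets of the Coxeter
   graph, which are counted by deleting vertices. *)

Require Import Defs.
From HB Require Import structures.
From mathcomp Require Import all_boot all_order all_fingroup all_algebra.
From mathcomp Require Import ring zify.

Set Implicit Arguments.
Unset Strict Implicit.
Unset Printing Implicit Defensive.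

(** * Inversion sets and the weak order *)

Lemma conjg_eq (G : groupType) (x y z : G) : ((x ^ z == y) = (x == y ^ z^-1))%g.
Proof. by apply/eqP/eqP => [<-|->]; rewrite (conjgK, conjgKV). Qed.

Section InversionSets.
Variables (I : finType) (W : finGroupType) (m : I -> I -> nat) (s : I -> W).
Hypotheses (hm : forall i, m i i = 1%N) (hs : coxeter_system m s).
Local Open Scope group_scope.

Lemma gen_sq i : s i * s i = 1.
Proof. by case: hs => _ /(_ i i); rewrite hm expg1. Qed.

Lemma gen_inv i : (s i)^-1 = s i.
Proof. by apply/eqP; rewrite eq_invg_mul gen_sq. Qed.

(** The bit of a point records the parity of the crossings of a reflection. The action is on all of
    [W], so that no set of reflections has to be singled out. *)
Definition refl_fun i (x : W * bool) := (x.1 ^ s i, x.2 (+) (x.1 == s i)).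

Lemma refl_funK i : involutive (refl_fun i).
Proof.
case=> x e; rewrite /refl_fun /= -conjgM gen_sq conjg1.
by rewrite conjg_eq conjgE invgK gen_inv mulgA gen_sq mul1g -addbA addbb addbF.
Qed.

Definition refl_perm i : {perm W * bool} := perm (inv_inj (refl_funK i)).

(* The reflections [(s i * s j) ^+ r * s i], for [r] below [2 m i j], are the ones
   crossed by the word [(s i s j)^(m i j)]; each of them is crossed twice. *)
Lemma refl_perm_relations : coxeter_relations m refl_perm.
Proof.
move=> i j; set c := s i * s j.
have cm : c ^+ m i j = 1 by case: hs => _ /(_ i j).
(* As in a dihedral group, conjugation by [s i] inverts the rotation [c]. *)
have ci r : s i * c ^- r = c ^+ r * s i.
  have -> : c ^- r = (c ^+ r) ^ s i.
    by rewrite conjXg conjgE /c -mulgA mulKg -expgVn invMg !gen_inv.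
  by rewrite conjgE gen_inv !mulgA gen_sq mul1g.
pose h r x := x == c ^+ r * s i.
have step r x : (x ^ (c ^+ r) == s i) = h r.*2 x.
  by rewrite conjg_eq conjgE invgK /h ci mulgA -expgD addnn.
have step' r x : ((x ^ (c ^+ r)) ^ s i == s j) = h r.*2.+1 x.
  rewrite !conjg_eq !conjgE !invgK gen_inv -!mulgA ci.
  by rewrite /h -addnn -addnS expgD expgS /c !mulgA.
have iterE r x e : ((refl_perm i * refl_perm j) ^+ r) (x, e) =
    (x ^ (c ^+ r), e (+) \big[addb/false]_(0 <= q < r.*2) h q x).
  elim: r => [|r IH]; first by rewrite big_geq //= perm1 conjg1 addbF.
  rewrite expgSr permM IH permM !permE /refl_fun /= step step'.
  by rewrite -!conjgM expgSr /c !mulgA doubleS !big_nat_recr //= !addbA.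
apply/permP => -[x e]; rewrite iterE cm conjg1 perm1; congr pair.
rewrite -addnn (@big_cat_nat _ _ _ (m i j)) ?leq_addr //=.
rewrite -{2}[m i j]add0n big_addn addnK.
under [in X in _ (+) (_ (+) X)]eq_bigr => q _ do rewrite /h expgD cm mulg1.
by rewrite addbb addbF.
Qed.

(** [N w] collects the elements whose bit is flipped by the image of [w]. That image conjugates the
    first coordinate by [w], so multiplicativity turns into the cocycle rule. *)
Lemma inversion_cocycle : exists N : W -> {set W},
  (forall i, N (s i) = [set s i]) /\
  (forall x y t, (t \in N (x * y)) = (t \in N x) (+) (t ^ x \in N y)).
Proof.
have [hgen _ /(_ _ _ refl_perm_relations) [f fE]] := hs.
have f1 : f 1 = 1 by apply: (mulgI (f 1)); rewrite -gmulfM !mulg1.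
(* Whether the bit is flipped does not depend on its initial value; this passes from the generators
   to their products. *)
have fP w : forall x e, f w (x, e) = (x ^ w, e (+) (f w (x, false)).2).
  have: w \in <<[set s i | i : I]>> by rewrite hgen inE.
  case/gen_prodgP => l [c hc ->].
  elim/big_rec: _ => [|k y _ IH] x e; first by rewrite f1 !perm1 conjg1 addbF.
  rewrite gmulfM !permM; have /imsetP[i _ ->] := hc k.
  by rewrite fE !permE /refl_fun /= IH [in RHS]IH /= conjgM addbA.
exists (fun w => [set x | (f w (x, false)).2]); split=> [i|x y t].
  by apply/setP=> x; rewrite !inE fE permE.
by rewrite !inE gmulfM permM (fP x) fP.
Qed.

End InversionSets.

Section WeakOrder.
Variables (I : finType) (W : finGroupType) (s : I -> W) (N : W -> {set W}).
Local Open Scope group_scope.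
Hypotheses (hgen : <<[set s i | i : I]>> = [set: W]) (hsq : forall i, s i * s i = 1).
Hypotheses (N_gen : forall i, N (s i) = [set s i]).
Hypotheses (in_NM : forall x y t, (t \in N (x * y)) = (t \in N x) (+) (t ^ x \in N y)).

Let S := [set s i | i : I].

Lemma N1 : N 1 = set0.
Proof.
apply/setP=> t; have := in_NM 1 1 t; rewrite mulg1 conjg1 inE.
by case: (t \in N 1).
Qed.

Lemma in_NV x t : (t \in N x^-1) = (t ^ x^-1 \in N x).
Proof.
have := in_NM x^-1 x t; rewrite mulVg N1 inE.
by case: (t \in N x^-1); case: (t ^ _ \in _).
Qed.

Lemma in_NV_conj x t : (t ^ x \in N x^-1) = (t \in N x).
Proof. by rewrite in_NV conjgK. Qed.

Lemma in_NVM x y t :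
  (t \in N (x^-1 * y)) = (t ^ x^-1 \in N x) (+) (t ^ x^-1 \in N y).
Proof. by rewrite in_NM in_NV. Qed.

(** Up to conjugation by [x], the set [N (x^-1 * y)] is the symmetric difference of [N x] and
    [N y]. *)
Lemma card_NVM x y : #|N (x^-1 * y)| = (#|N x :\: N y| + #|N y :\: N x|)%N.
Proof.
rewrite -cardsUI.
have -> : (N x :\: N y) :&: (N y :\: N x) = set0.
  by apply/setP=> t; rewrite !inE; case: (t \in N x); case: (t \in N y).
rewrite cards0 addn0 -[RHS](card_imset _ (@conjg_inj _ x)); congr #|pred_of_set _|.
apply/setP=> t; rewrite in_NVM; apply/idP/imsetP => [h|[r h ->]].
  exists (t ^ x^-1); last by rewrite conjgKV.
  by move: h; rewrite !inE; do 2 case: (_ \in _).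
by move: h; rewrite conjgK !inE; do 2 case: (_ \in _).
Qed.

Lemma word_exists w : exists t, w = \prod_(i <- t) s i.
Proof.
have: w \in <<S>> by rewrite hgen inE.
case/gen_prodgP => l [c hc ->].
elim/big_rec: _ => [|k y _ [t ->]]; first by exists [::]; rewrite big_nil.
by have /imsetP[i _ ->] := hc k; exists (i :: t); rewrite big_cons.
Qed.

Lemma s_neq1 i : s i != 1.
Proof.
by apply/negP => /eqP e; have := N_gen i; rewrite e N1 => /setP/(_ 1); rewrite !inE eqxx.
Qed.

(** This gives [#|N w| < #|W|], which keeps the length within the range searched by [cox_length]. *)
Lemma N_sub1 w : N w \subset [set~ 1].
Proof.
apply/subsetP=> x; rewrite !inE; apply: contraTneq => ->.
have [t ->] := word_exists w.
elim: t => [|i t IH]; first by rewrite big_nil N1 inE.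
by rewrite big_cons in_NM N_gen inE conj1g (negPf IH) addbF eq_sym s_neq1.
Qed.

(** Strong exchange: conjugating [x] by some prefix of the word gives the next letter, and
    multiplying by [x] on the left deletes that letter. *)
Lemma word_exchange t x : x \in N (\prod_(i <- t) s i) ->
  exists2 t', (size t').+1 = size t & x * \prod_(i <- t) s i = \prod_(i <- t') s i.
Proof.
elim: t x => [|i t IH] x; first by rewrite big_nil N1 inE.
rewrite big_cons in_NM N_gen inE.
case: eqP => [-> _|_] /=; first by exists t => //; rewrite mulgA hsq mul1g.
case/IH => t' <- E; exists (i :: t') => //.
by rewrite big_cons -E conjgE !mulgA mulgV mul1g.
Qed.

Lemma card_N_word t : #|N (\prod_(i <- t) s i)| <= size t.
Proof.
elim: t => [|i t IH]; first by rewrite big_nil N1 cards0.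
rewrite big_cons -[s i]invgK card_NVM; have -> : (s i)^-1 = s i.
  by apply/eqP; rewrite eq_invg_mul hsq.
rewrite N_gen /= -add1n leq_add //.
  by rewrite (leq_trans (subset_leq_card (subsetDl _ _))) // cards1.
by rewrite (leq_trans (subset_leq_card (subsetDl _ _))).
Qed.

Lemma card_N_genM i x :
  #|N (s i * x)| = if s i \in N x then #|N x|.-1 else #|N x|.+1.
Proof.
have sV : (s i)^-1 = s i by apply/eqP; rewrite eq_invg_mul hsq.
have -> : s i * x = (s i)^-1 * x by rewrite sV.
rewrite card_NVM N_gen (cardsD1 (s i) (N x)).
have -> : [set s i] :\: N x = if s i \in N x then set0 else [set s i].
  by apply/setP=> t; case: ifP => h; rewrite !inE; have [->|] := eqVneq; rewrite ?h ?andbF.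
by case: ifP => _; rewrite ?cards0 ?cards1.
Qed.

(** Letters of an arbitrary word are added from the right. A letter already among the inversions of
    the rest deletes a letter by exchange; any other letter raises both the word size and the number
    of inversions by one. *)
Lemma reduced_word w : exists2 t, size t = #|N w| & w = \prod_(i <- t) s i.
Proof.
have [t ->] := word_exists w.
elim: t => [|i t [t' st Et]]; first by exists [::]; rewrite ?big_nil ?N1 ?cards0.
rewrite big_cons card_N_genM Et; case: ifP => [|_].
  by case/word_exchange => t2 h ->; exists t2; rewrite -?Et // -st -h.
by exists (i :: t'); rewrite ?big_cons //= st Et.
Qed.

Lemma cox_lengthE w : cox_length s w = #|N w|.
Proof.
rewrite /cox_length; set P := fun l => _.
have NW : #|N w| < #|W|.
  by rewrite (leq_ltn_trans (subset_leq_card (N_sub1 w))) // cardsC1 prednK //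
     -cardsT cardG_gt0.
have PN : P #|N w|.
  have [t st Et] := reduced_word w; apply/existsP.
  by exists (tcast st (in_tuple t)); rewrite val_tcast -Et.
have hP : has P (iota 0 #|W|) by apply/hasP; exists #|N w| => //; rewrite mem_iota.
apply/eqP; rewrite eqn_leq; apply/andP; split.
  rewrite leqNgt; apply/negP => lt; have := before_find 0%N lt.
  by rewrite nth_iota // PN.
have := nth_find 0%N hP; rewrite has_find size_iota in hP.
rewrite nth_iota // add0n => /existsP[t /eqP <-].
by rewrite (leq_trans (card_N_word t)) ?size_tuple.
Qed.

(** By [card_NVM], additivity of lengths says exactly that [N u :\: N w] has no element. *)
Lemma right_weakE u w : right_weak s u w = (N u \subset N w).
Proof.
rewrite /right_weak !cox_lengthE card_NVM -setD_eq0 -cards_eq0.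
have := cardsID (N u) (N w); have := cardsID (N w) (N u); rewrite setIC; lia.
Qed.

Lemma N_inj : injective N.
Proof.
move=> x y e; have := card_NVM x y; rewrite e setDv cards0 => h.
have [t] := reduced_word (x^-1 * y); rewrite h.
by case: t => // _; rewrite big_nil => /eqP; rewrite -eq_mulVg1 => /eqP.
Qed.

Lemma N_S x : x \in S -> N x = [set x].
Proof. by case/imsetP => i _ ->. Qed.

Lemma card_N1 x : #|N x| = 1%N -> x \in S.
Proof.
move=> h; have [t] := reduced_word x; rewrite h.
case: t => [|i [|]] // _ ->; rewrite big_seq1; exact: imset_f.
Qed.

(** Conjugation by a factor fixes the other factors, and distinctness makes the exclusive or in the
    cocycle rule a union. *)
Lemma N_prod_commuting (t : seq W) : uniq t -> {subset t <= S} ->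
  {in t &, forall x y, commute x y} -> N (\prod_(x <- t) x) =i t.
Proof.
elim: t => [|x t IH] /=; first by move=> _ _ _ y; rewrite big_nil N1 inE.
case/andP => xt ut tS ct y; rewrite big_cons in_NM N_S ?tS ?mem_head // !inE.
have {}IH : N (\prod_(x <- t) x) =i t.
  by apply: IH => // [z zt|z z' zt zt']; [apply: tS|apply: ct]; rewrite inE ?zt ?zt' orbT.
rewrite IH; have [->|_] := eqVneq y x.
  by rewrite conjgE mulKg (negPf xt).
suff -> : (y ^ x \in t) = (y \in t) by [].
have fixt z : z \in t -> z ^ x = z.
  move=> zt; rewrite conjgE; suff -> : z * x = x * z by rewrite mulKg.
  by apply: ct; rewrite inE ?eqxx ?zt ?orbT.
apply/idP/idP => h; last by rewrite fixt.
by have := fixt _ h => /conjg_inj e; rewrite e in h.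
Qed.

Lemma N_prod (J : {set W}) : J \subset S -> abelian J -> N (\prod_(x in J) x) = J.
Proof.
move=> /subsetP JS cJ; apply/setP => x; rewrite -big_filter.
have mJ y : (y \in [seq y <- index_enum W | y \in J]) = (y \in J).
  by rewrite mem_filter mem_index_enum andbT.
rewrite N_prod_commuting ?filter_uniq ?index_enum_uniq //.
- by move=> y; rewrite mJ; apply: JS.
- by move=> y z; rewrite !mJ => yJ zJ; apply: (centsP cJ).
Qed.

(** * Boolean intervals as cosets *)

Local Notation w J := (\prod_(x in (J : {set W})) x).
Local Notation le := (right_weak s).

Definition commuting_gens k :=
  [set J : {set W} | [&& J \subset S, abelian J & #|J| == k]].

(** The generators in [N u^-1] are the right descents of [u], so disjointness from [J] says that [u]
    is shortest in its coset modulo the group generated by [J]. *)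
Definition min_coset_pairs k :=
  [set p : W * {set W} | (p.2 \in commuting_gens k) && [disjoint N p.1^-1 & p.2]].

Lemma commuting_gens_sub k (J X : {set W}) : J \in commuting_gens k -> X \subset J -> N (w X) = X.
Proof.
rewrite inE => /and3P[JS cJ _] XJ.
by rewrite N_prod ?(subset_trans XJ) ?(abelianS XJ).
Qed.

(** Minimality of [u] keeps the two terms of the cocycle rule from holding together, so the
    exclusive or is a plain disjunction. *)
Lemma in_N_coset k u (J X : {set W}) t : (u, J) \in min_coset_pairs k -> X \subset J ->
  (t \in N (u * w X)) = (t \in N u) || (t ^ u \in X).
Proof.
rewrite inE => /andP[/= hJ dJ] XJ; rewrite in_NM (commuting_gens_sub hJ) //.
have [tX|_] := boolP (t ^ u \in X); last by rewrite addbF orbF.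
have := disjointFl dJ (subsetP XJ _ tX).
by rewrite in_NV_conj => ->.
Qed.

(** For [x] in the interval the witness is [N (u^-1 * x)]. It lies in [J] because the inversions of
    [x] beyond those of [u] are conjugates of elements of [J], and [N_inj] then recovers [x]. *)
Lemma interval_coset k u (J : {set W}) x : (u, J) \in min_coset_pairs k ->
  reflect (exists2 X : {set W}, X \subset J & x = u * w X) (x \in Defs.interval le u (u * w J)).
Proof.
move=> h; have hJ : J \in commuting_gens k by move: h; rewrite inE => /andP[].
rewrite inE !right_weakE; apply: (iffP andP) => [[/subsetP ux /subsetP xJ]|[X XJ ->]].
  have NJ : N (u^-1 * x) \subset J.
    apply/subsetP => t; rewrite in_NVM.
    have := ux (t ^ u^-1); have := xJ (t ^ u^-1).
    rewrite (in_N_coset _ h) // conjgKV.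
    by case: (_ \in N u) => [_ -> //|]; case: (_ \in N x) => //= ->.
  exists (N (u^-1 * x)) => //; apply: (mulgI u^-1); rewrite mulKg; apply: N_inj.
  by rewrite (commuting_gens_sub hJ).
split; apply/subsetP => t; rewrite !(in_N_coset _ h) //; first by move=> ->.
by case/orP => [->|/(subsetP XJ) ->]; rewrite ?orbT.
Qed.

Lemma le_coset k u (J X Y : {set W}) : (u, J) \in min_coset_pairs k -> X \subset J -> Y \subset J ->
  le (u * w X) (u * w Y) = (X \subset Y).
Proof.
move=> h XJ YJ; rewrite right_weakE.
have /andP[/= _ dJ] : (J \in commuting_gens k) && [disjoint N u^-1 & J] by move: h; rewrite inE.
apply/subsetP/subsetP => hXY t; last first.
  by rewrite !(in_N_coset _ h) // => /orP[->//|/hXY ->]; rewrite orbT.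
move=> tX; have := hXY (t ^ u^-1).
rewrite !(in_N_coset _ h) // conjgKV tX orbT -in_NV.
by rewrite (disjointFl dJ (subsetP XJ _ tX)); apply.
Qed.

Lemma interval_coset_boolean k u (J : {set W}) : (u, J) \in min_coset_pairs k ->
  Defs.interval le u (u * w J) \in boolean_intervals le k.
Proof.
move=> h; rewrite inE; apply/andP; split.
  apply/existsP; exists u; apply/existsP; exists (u * w J); rewrite eqxx andbT.
  by rewrite right_weakE; apply/subsetP => t; rewrite (in_N_coset _ h) // => ->.
have cJ : #|J| = k by move: h; rewrite !inE => /andP[/and3P[_ _ /eqP]].
subst k; pose g (X : {set 'I_#|J|}) := enum_val @: X.
have gJ X : g X \subset J by apply/subsetP => _ /imsetP[i _ ->]; apply: enum_valP.
apply/existsP; exists [ffun X => u * w (g X)]; apply/andP; split.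
  apply/eqP/setP => x; apply/imsetP/(interval_coset _ h) => [[X _ ->]|[X XJ ->]].
    by rewrite ffunE; exists (g X).
  exists (enum_val @^-1: X) => //; rewrite ffunE; congr (_ * _).
  suff -> : g (enum_val @^-1: X) = X by [].
  apply/setP => t; apply/imsetP/idP => [[i + ->]|tX]; first by rewrite inE.
  exists (enum_rank_in (subsetP XJ _ tX) t); rewrite ?inE enum_rankK_in ?(subsetP XJ) //.
apply/forallP => X; apply/forallP => Y; rewrite !ffunE (le_coset h) //.
apply/eqP; apply/idP/idP => [/subsetP XY|XY]; last exact: imsetS.
apply/subsetP => i iX; have := XY (enum_val i); rewrite imset_f // => /(_ isT).
by case/imsetP => j jY /enum_val_inj ->.
Qed.

Lemma N_antisym u v : N u \subset N v -> N v \subset N u -> u = v.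
Proof. by move=> uv vu; apply: N_inj; apply/eqP; rewrite eqEsubset uv. Qed.

Lemma N_mulS u g : g \in S -> g ^ u^-1 \notin N u -> N (u * g) = g ^ u^-1 |: N u.
Proof.
move=> gS gu; apply/setP => t; rewrite in_NM (N_S gS) !inE conjg_eq.
by have [->|] := eqVneq t; rewrite ?(negPf gu) ?addbF.
Qed.

(** The first letter of a reduced word for [u^-1 * v] gives an upward step from [u] that stays below
    [v]. *)
Lemma cover_step u v : N u \subset N v -> u != v ->
  exists2 g, g \in S & (g ^ u^-1 \in N v) && (g ^ u^-1 \notin N u).
Proof.
move=> /subsetP uv nuv; have [t] := reduced_word (u^-1 * v).
case: t => [_ /eqP|i t /= st]; first by rewrite big_nil -eq_mulVg1 (negPf nuv).
rewrite big_cons => E; exists (s i); first exact: imset_f.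
have : s i \in N (u^-1 * v).
  move: st; rewrite E card_N_genM; case: ifP => [_ st|h].
    by have := card_N_word t; rewrite -ltnS st => /leq_trans/(_ (leq_pred _)); rewrite ltnn.
  move=> _; rewrite in_NM N_gen inE eqxx conjgE mulKg.
  by rewrite h.
by rewrite in_NVM; have := uv (s i ^ u^-1); case: (_ \in N u) => [/(_ isT) ->|_ /= ->].
Qed.

(** Either of [a] and [b] can be the first letter of a reduced word of [z], and the cocycle rule
    determines the second letter; the two words are [a * b] and [b * a]. *)
Lemma rank2_commute a b z : a \in S -> b \in S -> a != b -> N z = [set a; b] ->
  commute a b.
Proof.
have aux x y : x \in S -> x != y -> N z = [set x; y] -> z = y * x.
  move=> /imsetP[i _ ->] xy Nz; set p := s i * z.
  have Ez : z = s i * p by rewrite /p mulgA hsq mul1g.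
  have pS : p \in S by apply: card_N1; rewrite card_N_genM Nz inE !inE eqxx cards2 xy.
  have: y \in N (s i * p) by rewrite -Ez Nz !inE eqxx orbT.
  rewrite in_NM N_gen (N_S pS) !inE eq_sym (negPf xy) /= => /eqP e.
  by rewrite Ez -e conjgE !mulgA mulgV mul1g.
move=> aS bS ab Nz; rewrite /commute -(aux b a) //; last by rewrite setUC.
  exact: aux.
by rewrite eq_sym.
Qed.

(** The atoms of the interval are [u * g i] with [g i] generators, and [J] is the set of the [g i].
    Each pair of atoms spans an element whose inversions over [u] are [g i] and [g j], so these
    commute; the whole of [J] accounts for the top element. *)
Lemma boolean_interval_coset k A : A \in boolean_intervals le k ->
  exists2 p, p \in min_coset_pairs k & A = Defs.interval le p.1 (p.1 * w p.2).
Proof.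
rewrite inE => /andP[/existsP[u /existsP[v /andP[uv /eqP EA]]]].
rewrite right_weakE in uv.
case/existsP => f /andP[/eqP imf /forallP emb].
have fle X Y : (N (f X) \subset N (f Y)) = (X \subset Y).
  by rewrite -right_weakE (eqP (forallP (emb X) Y)).
have inA x : (x \in A) = (N u \subset N x) && (N x \subset N v).
  by rewrite EA inE !right_weakE.
have fA X : (N u \subset N (f X)) && (N (f X) \subset N v) by rewrite -inA -imf imset_f.
have fsurj x : N u \subset N x -> N x \subset N v -> exists X, x = f X.
  move=> h1 h2; have: x \in A by rewrite inA h1.
  by rewrite -imf => /imsetP[X _ ->]; exists X.
have finj : injective f.
  by move=> X Y e; apply/eqP; rewrite eqEsubset -!fle e !subxx.
have f0 : f set0 = u.
  have [X0 e] := fsurj u (subxx _) uv.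
  have /andP[h _] := fA set0; apply: N_antisym h; rewrite [in N u]e fle; exact: sub0set.
have fT : f setT = v.
  have [X0 e] := fsurj v uv (subxx _).
  have /andP[_ h] := fA setT; apply: N_antisym h _; rewrite [in N v]e fle; exact: subsetT.
(* No subset lies strictly between [X] and [i |: X], so the step upward from [f X] given by
   [cover_step] already reaches [f (i |: X)]. *)
have step (X : {set 'I_k}) i : i \notin X ->
  exists g, [/\ g \in S, f (i |: X) = f X * g & g ^ (f X)^-1 \notin N (f X)].
  move=> iX; have [||g gS /andP[g1 g2]] := @cover_step (f X) (f (i |: X)).
  - by rewrite fle subsetUr.
  - rewrite (inj_eq finj); apply: contraNneq iX => ->; exact: setU11.
  exists g; split=> //; have NXg := N_mulS gS g2.
  have /andP[uX _] := fA X; have /andP[_ Xv] := fA (i |: X).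
  have le1 : N (f X) \subset N (f X * g) by rewrite NXg subsetUr.
  have le2 : N (f X * g) \subset N (f (i |: X)).
    by rewrite NXg subUset sub1set g1 fle subsetUr.
  have [Y EY] := fsurj _ (subset_trans uX le1) (subset_trans le2 Xv).
  rewrite EY; rewrite EY !fle in le1 le2; suff -> : Y = i |: X by [].
  apply/eqP; rewrite eqEsubset le2 subUset le1 andbT sub1set /=.
  apply: contraT => iY; have XY : X = Y.
    apply/eqP; rewrite eqEsubset le1; apply/subsetP => j jY.
    have := subsetP le2 j jY; rewrite !inE; case: eqP => // e.
    by rewrite e (negPf iY) in jY.
  by move: NXg; rewrite EY -XY => E; move: g2; rewrite [in N _]E setU11.
have cardf (X : {set 'I_k}) : #|N (f X)| = (#|N u| + #|X|)%N.
  move e: #|X| => c; elim: c X e => [|c IH] X e.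
    by rewrite (cards0_eq e) f0 addn0.
  have /card_gt0P[i iX] : 0 < #|X| by rewrite e.
  have [|g [gS E g2]] := step (X :\ i) i; first by rewrite setD11.
  rewrite setD1K // in E; rewrite E N_mulS // cardsU1 g2 IH ?addnS //.
  by move: e; rewrite (cardsD1 i) iX => -[].
pose g i := u^-1 * f [set i].
have gP i : [/\ g i \in S, g i ^ u^-1 \notin N u & N (f [set i]) = g i ^ u^-1 |: N u].
  have [|h [hS]] := step set0 i; first by rewrite inE.
  rewrite setU0 f0 => E hu; have -> : g i = h by rewrite /g E mulKg.
  by split=> //; rewrite E N_mulS.
have ginj : injective g by move=> i j /mulgI/finj/set1_inj.
(* The atoms below [f X] give one inclusion, and [cardf] shows that the two sets have equal size. *)
have Ng (X : {set 'I_k}) : N (u^-1 * f X) = g @: X.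
  apply/esym/eqP; rewrite eqEcard card_imset // card_NVM cardsD.
  have /andP[uX _] := fA X; rewrite (setIidPl uX) subnn add0n cardsD (setIidPr uX) cardf.
  rewrite addKn leqnn andbT; apply/subsetP => _ /imsetP[i iX ->].
  have [_ g1 g2] := gP i; rewrite in_NVM (negPf g1) /=.
  have: N (f [set i]) \subset N (f X) by rewrite fle sub1set.
  by rewrite g2 => /subsetP; apply; rewrite setU11.
pose J := g @: [set: 'I_k].
have JS : J \subset S by apply/subsetP => _ /imsetP[i _ ->]; have [] := gP i.
have cJ : abelian J.
  apply/centsP => _ /imsetP[i _ ->] _ /imsetP[j _ ->].
  have [->//|ij] := eqVneq i j.
  have [iS _ _] := gP i; have [jS _ _] := gP j.
  apply: (rank2_commute (z := u^-1 * f [set i; j])) => //; first by rewrite (inj_eq ginj).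
  by rewrite Ng imsetU !imset_set1.
exists (u, J) => /=.
  rewrite !inE /= JS cJ card_imset // cardsT card_ord eqxx /=.
  rewrite disjoint_sym; apply/pred0P => x /=; apply/negP => /andP[/imsetP[i _ ->]].
  by rewrite in_NV; have [_ /negPf->] := gP i.
rewrite EA; congr (Defs.interval _ _ _); apply: (mulgI u^-1); rewrite mulKg; apply: N_inj.
by rewrite N_prod // -fT Ng.
Qed.

(** The least and greatest elements of the interval determine [u] and [u * w J], and [J] is the
    inversion set of [w J]. *)
Lemma interval_coset_inj k :
  {in min_coset_pairs k &, injective (fun p => Defs.interval le p.1 (p.1 * w p.2))}.
Proof.
move=> [u J] [u' J'] h h' /= E.
have hb u1 J1 : (u1, J1) \in min_coset_pairs k ->
    u1 \in Defs.interval le u1 (u1 * w J1) /\ u1 * w J1 \in Defs.interval le u1 (u1 * w J1).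
  move=> h1; have le1 : le u1 (u1 * w J1).
    by rewrite right_weakE; apply/subsetP => t; rewrite (in_N_coset _ h1) // => ->.
  by rewrite !inE le1 !right_weakE !subxx.
have [a b] := hb _ _ h; have [a' b'] := hb _ _ h'.
have e : u = u'.
  rewrite E in a; rewrite -E in a'; move: a a'; rewrite !inE !right_weakE.
  by move=> /andP[h1 _] /andP[h2 _]; apply: N_antisym.
subst u'; rewrite E in b; rewrite -E in b'; move: b b'; rewrite !inE !right_weakE.
move=> /andP[_ h1] /andP[_ h2]; have /mulgI e := N_antisym h1 h2.
congr pair; move: h h'; rewrite !inE => /andP[/= H _] /andP[/= H' _].
by rewrite -(@commuting_gens_sub k J J) ?inE // e (@commuting_gens_sub k J' J') ?inE.
Qed.

Lemma card_boolean_intervals k : #|boolean_intervals le k| = #|min_coset_pairs k|.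
Proof.
rewrite -(card_in_imset (@interval_coset_inj k)); congr #|pred_of_set _|.
apply/setP => A; apply/idP/imsetP => [/boolean_interval_coset[p hp ->]|[[u J] hp ->]].
  by exists p.
exact: interval_coset_boolean.
Qed.

(** [W] is partitioned by the set [X] of right descents lying in [J]. Right multiplication by [w X]
    maps the class of the empty set onto that of [X], so the [2 ^ #|J|] classes have equal size. *)
Lemma card_min_cosets (J : {set W}) : J \subset S -> abelian J ->
  (#|[set u | [disjoint N u^-1 & J]]| * 2 ^ #|J| = #|W|)%N.
Proof.
move=> JS cJ; set A0 := [set u | _].
have A0E u : (u \in A0) = (N u^-1 :&: J == set0) by rewrite inE setI_eq0.
rewrite -card_powerset mulnC -sum_nat_const -[RHS]sum1_card.
rewrite (partition_big (fun u => N u^-1 :&: J) (mem (powerset J))) /=; last first.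
  by move=> u _; rewrite inE subsetIr.
apply: eq_bigr => X; rewrite inE => XJ.
rewrite -(card_rcoset _ (w X)) -sum1_card; apply: eq_bigl => u.
rewrite mem_rcoset A0E; set v := u * _.
have -> : u = v * w X by rewrite /v mulgKV.
have cw t : t \in J -> t ^ (w X)^-1 = t.
  move=> tJ; have : w X \in 'C(J).
    by apply: group_prod => x /(subsetP XJ); apply: subsetP.
  by move=> /centP/(_ t tJ) c; rewrite conjgE invgK mulgA c mulgK.
have NX : N (w X) = X by rewrite N_prod ?(subset_trans XJ) ?(abelianS XJ).
(* As [w X] centralizes [J], multiplying by it toggles exactly the elements of [X] among the
   descents in [J]. *)
have mE t : t \in J -> (t \in N (v * w X)^-1) = (t \in X) (+) (t \in N v^-1).
  by move=> tJ; rewrite invMg in_NVM cw // NX.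
apply/eqP/eqP => E; apply/setP => t; move/setP/(_ t): E; rewrite !inE.
  case: (boolP (t \in J)) => tJ; last by move: tJ; rewrite !andbF; case: (boolP (t \in X)) => // /(subsetP XJ) ->.
  by rewrite mE // !andbT => ->; rewrite addbF.
case: (boolP (t \in J)) => tJ; last by rewrite !andbF.
by rewrite mE // !andbT; do 2 case: (_ \in _).
Qed.

Lemma card_min_coset_pairs k :
  (#|min_coset_pairs k| * 2 ^ k = #|commuting_gens k| * #|W|)%N.
Proof.
have -> : #|min_coset_pairs k| =
    (\sum_(J in commuting_gens k) #|[set u | [disjoint N u^-1 & J]]|)%N.
  under eq_bigr do rewrite -sum1_card.
  rewrite (exchange_big_dep predT) //= pair_big_dep /= -sum1_card.
  by apply: eq_bigl => -[u J]; rewrite !inE.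
rewrite big_distrl -sum_nat_const; apply: eq_bigr => J.
by rewrite inE => /and3P[JS cJ /eqP <-]; apply: card_min_cosets.
Qed.

End WeakOrder.

(** * The order of the group of type D *)

Section TypeDCosets.
Variables (W : finGroupType) (M : nat) (a : nat -> W) (b : W).
Local Open Scope group_scope.
Hypotheses (aK : forall j, a j * a j = 1) (bK : b * b = 1).
Hypothesis aC : forall j k, j.+1 < k <= M -> a j * a k = a k * a j.
Hypothesis aB : forall j, j < M -> a j * a j.+1 * a j = a j.+1 * a j * a j.+1.
Hypothesis bC : forall j, j <= M -> j.+1 != M -> a j * b = b * a j.
Hypothesis bB : forall j, j.+1 = M -> a j * b * a j = b * a j * b.

(** The [a j] with [j <= M] form a path, and [b] is a twin of its end [a M]. The guard [d <= M]
    drops [b] at [d = M.+1], where the tail group becomes trivial. *)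
Definition tail_gens d : {set W} :=
  [set a (val i) | i in [set i : 'I_M.+1 | d <= i]] :|: [set x | (d <= M) && (x == b)].
Definition tail_group d := <<tail_gens d>>.

Lemma tail_gensP d g : g \in tail_gens d ->
  (exists2 j, d <= j <= M & g = a j) \/ (d <= M /\ g = b).
Proof.
rewrite !inE => /orP[/imsetP[i]|/andP[dM /eqP]]; last by right.
by rewrite inE => di ->; left; exists i => //; rewrite di -ltnS ltn_ord.
Qed.

Lemma a_tail d j : d <= j <= M -> a j \in tail_group d.
Proof.
move=> /andP[dj jM]; apply: mem_gen; rewrite inE; apply/orP; left.
by apply/imsetP; exists (inord j); rewrite ?inE /= inordK.
Qed.

Lemma b_tail d : d <= M -> b \in tail_group d.
Proof. by move=> dM; apply: mem_gen; rewrite !inE dM eqxx orbT. Qed.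

(* [tail_path d i] moves the point [d] to [i], and [flip d] negates it, see
   [tail_path_act] and [flip_act]. *)
Definition tail_path d i := \prod_(d <= k < i) a k.

Lemma tail_path_recr d i : d <= i -> tail_path d i.+1 = tail_path d i * a i.
Proof. by move=> di; rewrite /tail_path big_nat_recr. Qed.

Lemma tail_path_id d : tail_path d d = 1. Proof. by rewrite /tail_path big_geq. Qed.

Lemma tail_path_commute d i x : (forall k, d <= k < i -> a k * x = x * a k) ->
  tail_path d i * x = x * tail_path d i.
Proof.
move=> h; rewrite /tail_path big_nat; elim/big_rec: _ => [|k y hk IH].
  by rewrite mulg1 mul1g.
by rewrite -mulgA IH !mulgA h.
Qed.

Lemma tail_path_far d i j : i < j <= M -> tail_path d i * a j = a j * tail_path d i.
Proof. by move=> h; apply: tail_path_commute => k hk; apply: aC; lia. Qed.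

(** The letter [a j] commutes with all factors from [a j.+2] on, is turned into [a j.+1] by the
    braid relation, and then commutes with all factors before [a j]. *)
Lemma tail_path_shift d i j : d <= j -> j.+1 < i <= M.+1 ->
  tail_path d i * a j = a j.+1 * tail_path d i.
Proof.
move=> dj /andP[ji iM].
have -> : tail_path d i = tail_path d j * (a j * a j.+1 * tail_path j.+2 i).
  rewrite /tail_path (@big_cat_nat _ _ _ j) //=; last exact: ltnW (ltnW ji).
  by rewrite (big_ltn (ltnW ji)) (big_ltn ji) !mulgA.
rewrite -!mulgA (@tail_path_commute j.+2) => [|k hk]; last by apply/esym/aC; lia.
transitivity (tail_path d j * (a j * a j.+1 * a j) * tail_path j.+2 i); first by rewrite !mulgA.
by rewrite aB ?mulgA ?tail_path_far //; lia.
Qed.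

Definition flip d := tail_path d M.+1 * b * (tail_path d M)^-1.

Lemma flip_pathM d : flip d * tail_path d M = tail_path d M.+1 * b.
Proof. by rewrite /flip mulgKV. Qed.

Lemma flip_pathSM d : d <= M -> flip d * tail_path d M.+1 = tail_path d M * b.
Proof.
move=> dM; rewrite /flip tail_path_recr // -!mulgA mulKg.
by rewrite -bC ?(mulgA (a M)) ?aK ?mul1g //; lia.
Qed.

Lemma tail_path_conjV d i x y : tail_path d i * x = y * tail_path d i -> (tail_path d i)^-1 * y = x * (tail_path d i)^-1.
Proof. by move=> e; apply: (mulgI (tail_path d i)); rewrite mulKVg mulgA e mulgK. Qed.

Lemma flip_a d j : d < j < M -> flip d * a j = a j * flip d.
Proof.
move=> /andP[]; case: j => // j dj jM; rewrite /flip -!mulgA.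
rewrite (@tail_path_conjV _ _ (a j)); last by apply: tail_path_shift; lia.
rewrite (mulgA b) -bC; [|lia|lia].
by rewrite !mulgA tail_path_shift //; lia.
Qed.

(** Writing [tail_path d M] as [q * a m] with [m = M.-1], the factor [q] commutes with [a M] and
    [b]; what remains is a computation with the braid relations among [a m], [a M] and [b]. *)
Lemma flip_last d : d < M -> flip d * a M = b * flip d.
Proof.
move=> dM; pose m := M.-1; have Mm : m.+1 = M by rewrite /m prednK //; lia.
pose q := tail_path d m; have q1 : tail_path d M = q * a m by rewrite -{1}Mm tail_path_recr //; lia.
have q2 : tail_path d M.+1 = q * a m * a M by rewrite tail_path_recr ?q1 //; lia.
have qM : q * a M = a M * q by apply: tail_path_far; lia.
have qb : q * b = b * q by apply: tail_path_commute => k hk; apply: bC; lia.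
have Em : a m * a M * a m = a M * a m * a M by rewrite -Mm aB // Mm.
have Eb := bB Mm; have Mb : a M * b = b * a M by apply: bC; lia.
have q3 : q^-1 * a M = a M * q^-1 by apply: tail_path_conjV.
have aV : (a m)^-1 = a m by apply/eqP; rewrite eq_invg_mul aK.
rewrite /flip q1 q2 invMg aV.
transitivity (q * a m * (a M * b * (a m * a M)) * q^-1).
  by rewrite -!mulgA q3.
transitivity (q * a m * (b * (a M * a m * a M)) * q^-1).
  by rewrite Mb !mulgA.
rewrite -Em.
transitivity (q * (a m * b * a m) * a M * a m * q^-1); first by rewrite !mulgA.
by rewrite Eb !mulgA qb -!mulgA (mulgA b (a M)) -Mb !mulgA.
Qed.

Lemma flip_b d : d < M -> flip d * b = a M * flip d.
Proof.
move=> dM; pose m := M.-1; have Mm : m.+1 = M by rewrite /m prednK //; lia.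
pose q := tail_path d m; have q1 : tail_path d M = q * a m by rewrite -{1}Mm tail_path_recr //; lia.
have qb : q * b = b * q by apply: tail_path_commute => k hk; apply: bC; lia.
have q3 : q^-1 * b = b * q^-1 by apply: tail_path_conjV.
have aV : (a m)^-1 = a m by apply/eqP; rewrite eq_invg_mul aK.
have Pm : tail_path d M.+1 * a m = a M * tail_path d M.+1.
  by have := @tail_path_shift d M.+1 m; rewrite Mm; apply; lia.
have -> : flip d = tail_path d M.+1 * b * a m * q^-1 by rewrite /flip q1 invMg aV !mulgA.
transitivity (tail_path d M.+1 * b * (a m * b * a m) * a m * q^-1).
  by rewrite -!mulgA q3 (mulgA (a m) (a m)) aK mul1g.
rewrite bB // !mulgA -Pm; congr (_ * _ * _); rewrite -(mulgA _ b b) bK mulg1 //.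
Qed.

(** Conjugation by [flip d] acts as the diagram symmetry of the smaller tail: it fixes the inner
    generators and exchanges [a M] with [b]. *)
Lemma flip_norm d : flip d \in 'N(tail_group d.+1).
Proof.
rewrite -groupV inE -genJ gen_subG; apply/subsetP => _ /imsetP[g /tail_gensP hg ->].
rewrite conjgE invgK mulgA; case: hg => [[j hj ->]|[dM ->]]; last first.
  by rewrite flip_b // mulgK a_tail // dM /=.
have [->|jM] := eqVneq j M; first by rewrite flip_last ?mulgK ?b_tail //; lia.
by rewrite flip_a ?mulgK ?a_tail //; lia.
Qed.

(** The set [U] of such normal forms contains 1 and is stable under right multiplication by the
    generators. A generator lengthens or shortens the path, toggles the flip, or passes into the
    smaller tail group. *)
Lemma tail_group_decomp d x : d <= M -> x \in tail_group d ->
  exists h e i, [/\ h \in tail_group d.+1, d <= i <= M.+1 &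
                    x = h * flip d ^+ (e : bool) * tail_path d i].
Proof.
move=> dM; pose U := [set x | [exists h in tail_group d.+1, exists e : bool,
  exists i : 'I_M.+2, (d <= i) && (x == h * flip d ^+ e * tail_path d i)]].
have UP y : reflect (exists h e i, [/\ h \in tail_group d.+1, d <= i <= M.+1 &
    y = h * flip d ^+ (e : bool) * tail_path d i]) (y \in U).
  rewrite inE; apply: (iffP existsP) => [[h /andP[hh /existsP[e /existsP[i /andP[di /eqP ->]]]]]|].
    by exists h, e, (val i); rewrite di -ltnS ltn_ord.
  move=> [h [e [i [hh /andP[di iM] ->]]]]; exists h; rewrite hh; apply/existsP; exists e.
  by apply/existsP; exists (inord i); rewrite inordK ?di ?eqxx.
have Ug y g : y \in U -> g \in tail_gens d -> y * g \in U.
  move=> /UP[h [e [i [hh /andP[di iM] ->]]]] /tail_gensP hg; apply/UP.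
  (* A letter that crosses the path as an element of the smaller tail group is carried across the
     flip by [flip_norm]. *)
  have move_in k : k \in tail_group d.+1 -> tail_path d i * g = k * tail_path d i ->
    exists h' e' i', [/\ h' \in tail_group d.+1, d <= i' <= M.+1 &
      h * flip d ^+ e * tail_path d i * g = h' * flip d ^+ (e' : bool) * tail_path d i'].
    move=> hk E; exists (h * k ^ (flip d ^+ e)^-1), e, i; split; last 1 first.
    - by rewrite conjgE invgK -!mulgA E mulKg.
    - by rewrite groupM // memJ_norm // groupV groupX // flip_norm.
    by rewrite di.
  case: hg => [[j /andP[dj jM] Eg]|[_ Eg]]; subst g.
    have [E|ij] := eqVneq j i.
      by exists h, e, i.+1; split; rewrite ?hh ?tail_path_recr ?mulgA ?E //; lia.
    have [E|ij'] := eqVneq j.+1 i.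
      by exists h, e, j; split; rewrite ?hh // -?E ?tail_path_recr -?mulgA ?aK ?mulg1 //; lia.
    have [lt|lt] := ltnP i j.
      by apply: (move_in (a j)); rewrite ?a_tail ?tail_path_far //; lia.
    by apply: (move_in (a j.+1)); rewrite ?a_tail ?tail_path_shift //; lia.
  have [lt|] := ltnP i M.
    apply: (move_in b); first by apply: b_tail; lia.
    by apply: tail_path_commute => k hk; apply: bC; lia.
  (* On the two last positions, [b] exchanges [M] with [M.+1] and toggles the flip. *)
  move=> {move_in} Mi; have [E|E] : i = M \/ i = M.+1 by lia.
    exists h, (~~ e), M.+1; rewrite hh E leqnn; split=> //; first by lia.
    case: e; rewrite /= ?expg1 expg0 -!(mulgA h); congr (_ * _).
      by rewrite flip_pathM mul1g -mulgA bK mulg1.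
    by rewrite mul1g flip_pathSM.
  exists h, (~~ e), M; rewrite hh E leqnSn; split=> //; first by rewrite dM.
  case: e; rewrite /= ?expg1 expg0 -!(mulgA h); congr (_ * _).
    by rewrite flip_pathSM // mul1g -mulgA bK mulg1.
  by rewrite mul1g flip_pathM.
case/gen_prodgP => l [c hc ->]; apply/UP.
suff H y : y \in U -> y * \prod_i c i \in U.
  rewrite -[\prod_i _]mul1g; apply: H; apply/UP; exists 1, false, d.
  by rewrite group1 leqnn tail_path_id !mulg1; split=> //; lia.
elim/big_rec: _ y => [|k y _ IH] x0 hx; first by rewrite mulg1.
by rewrite mulgA; apply: IH; apply: Ug.
Qed.

Variable f : {multiplicative W -> {perm 'I_M.+2 * bool}}.
Hypothesis fa : forall j x e, j <= M ->
  f (a j) (x, e) = (tperm (inord j) (inord j.+1) x, e).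
Hypothesis fb : forall x e,
  f b (x, e) = (tperm (inord M) (inord M.+1) x, e (+) (M <= x)).

Lemma inord_eq i j : i <= M.+1 -> j <= M.+1 -> (inord i == inord j :> 'I_M.+2) = (i == j).
Proof. by move=> hi hj; rewrite -val_eqE /= !inordK. Qed.

Lemma tail_group_fix d h e : d <= M -> h \in tail_group d.+1 ->
  f h (inord d, e) = (inord d, e).
Proof.
move=> dM /gen_prodgP[l [c hc ->]].
have f1 : f 1 = 1 by apply: (mulgI (f 1)); rewrite -gmulfM !mulg1.
elim/big_rec: _ => [|k y _ IH]; first by rewrite f1 perm1.
rewrite gmulfM permM; suff -> : f (c k) (inord d, e) = (inord d, e) by [].
have [[j hj ->]|[hd ->]] := tail_gensP (hc k).
  by rewrite fa ?tpermD ?inord_eq //; lia.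
by rewrite fb tpermD ?inord_eq ?inordK //; try lia; rewrite leqNgt hd addbF.
Qed.

Lemma tail_path_act d i e : d <= i <= M.+1 -> f (tail_path d i) (inord d, e) = (inord i, e).
Proof.
have f1 : f 1 = 1 by apply: (mulgI (f 1)); rewrite -gmulfM !mulg1.
elim: i => [|i IH] /andP[di iM].
  by have -> : d = 0%N by [lia]; rewrite tail_path_id f1 perm1.
have [->|ne] := eqVneq d i.+1; first by rewrite tail_path_id f1 perm1.
by rewrite tail_path_recr ?gmulfM ?permM ?IH ?fa ?tpermL //; lia.
Qed.

Lemma flip_act d e : d <= M -> f (flip d) (inord d, e) = (inord d, ~~ e).
Proof.
move=> dM; apply: (@perm_inj _ (f (tail_path d M))).
rewrite -permM -gmulfM flip_pathM gmulfM permM !tail_path_act ?leqnn ?dM ?leqnSn ?leqW //.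
by rewrite fb tpermR inordK // leqnSn addbT.
Qed.

(** The normal form is unique: the image of the point [d] with positive sign reveals the endpoint
    and the sign, and cancellation then gives [h]. The index counts the signed points from [d] to
    [M.+1]. *)
Lemma card_tail_group_step d : d <= M ->
  #|tail_group d| = (2 * (M.+2 - d) * #|tail_group d.+1|)%N.
Proof.
move=> dM; pose D := setX (tail_group d.+1) (setX [set: bool] [set i : 'I_M.+2 | d <= i]).
pose F (p : W * (bool * 'I_M.+2)) := p.1 * flip d ^+ p.2.1 * tail_path d p.2.2.
have tS : tail_group d.+1 \subset tail_group d.
  rewrite gen_subG; apply/subsetP => _ /tail_gensP[[j hj ->]|[hd ->]].
    by apply: a_tail; lia.
  exact: b_tail.
have pT i : d <= i <= M.+1 -> tail_path d i \in tail_group d.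
  move=> hi; rewrite /tail_path big_nat; apply: group_prod => k hk; apply: a_tail; lia.
have ED : tail_group d = F @: D.
  apply/setP => x; apply/idP/imsetP => [/(tail_group_decomp dM)[h [e [i [hh hi ->]]]]|].
    exists (h, (e, inord i)); rewrite /F /= ?inordK //; last by lia.
    by rewrite !inE /= hh inordK; lia.
  case=> -[h [e i]]; rewrite !inE /= => /andP[hh di] ->; rewrite /F /=.
  have iM : i <= M.+1 by rewrite -ltnS.
  have zT : flip d \in tail_group d.
    by rewrite 2?groupM ?groupV ?b_tail ?pT // ?dM ?leqnn ?leqnSn ?leqW.
  by apply: groupM; [apply: groupM; [apply: (subsetP tS)|apply: groupX]|apply: pT; rewrite di].
have f1 : f 1 = 1 by apply: (mulgI (f 1)); rewrite -gmulfM !mulg1.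
have FE p : p \in D -> f (F p) (inord d, false) = (p.2.2, p.2.1).
  case: p => h [e i]; rewrite !inE /= => /andP[hh di]; rewrite /F /= !gmulfM !permM.
  rewrite tail_group_fix //.
  have -> : f (flip d ^+ e) (inord d, false) = (inord d, e).
    case: e => /=; first by rewrite flip_act.
    by rewrite f1 perm1.
  by rewrite tail_path_act ?inord_val // di -ltnS ltn_ord.
rewrite ED card_in_imset; last first.
  move=> [h [e i]] [h' [e' i']] p1 p2 E.
  have [ei ee] : (i, e) = (i', e') by have := FE _ p1; rewrite E FE.
  by move: E; rewrite ei ee /F /= => /mulIg/mulIg ->.
rewrite !cardsX cardsT card_bool mulnC; congr (2 * _ * _)%N.
rewrite -sum1dep_card -(big_mkord (fun i => d <= i) (fun=> 1%N)).
rewrite (@big_cat_nat _ _ _ d) //=; last by lia.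
rewrite big_nat_cond big_pred0 ?add0n => [|i]; last by lia.
rewrite big_nat_cond (eq_bigl (fun i => (d <= i < M.+2) && true)) => [|i]; last by lia.
by rewrite -big_nat_cond sum_nat_const_nat muln1.
Qed.

Lemma card_tail_group d : d <= M.+1 ->
  #|tail_group d| = (2 ^ (M.+1 - d) * (M.+2 - d)`!)%N.
Proof.
(* The induction runs downward from the trivial group at [d = M.+1], with [c] the distance from
   it. *)
move=> dM; rewrite -(subKn dM); move: (M.+1 - d)%N (leq_subr d M.+1) => c.
elim: c => [|c IH] cM.
  rewrite subn0 subnn subSn // subnn /=.
  suff -> : tail_group M.+1 = 1 by rewrite cards1.
  apply/trivgP; rewrite gen_subG; apply/subsetP => x /tail_gensP[[j hj]|[]]; lia.
rewrite card_tail_group_step ?subnSK ?IH //; try lia.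
have -> : (M.+1 - (M.+1 - c) = c)%N by lia.
have -> : (M.+1 - (M.+1 - c.+1) = c.+1)%N by lia.
have -> : (M.+2 - (M.+1 - c) = c.+1)%N by lia.
have -> : (M.+2 - (M.+1 - c.+1) = c.+2)%N by lia.
by rewrite expnS [in RHS]factS; lia.
Qed.

End TypeDCosets.

(** * The action of the type D generators on signed points *)

Section SignedPermutations.
Variable M : nat.
Local Open Scope group_scope.
Local Notation pt := ('I_M.+2 * bool)%type.

Definition lift_fun (t : {perm 'I_M.+2}) (x : pt) : pt := (t x.1, x.2).
Lemma lift_fun_inj t : injective (lift_fun t).
Proof. by move=> [x e] [y e'] [/perm_inj -> ->]. Qed.
Definition lift_signed t : {perm pt} := perm (@lift_fun_inj t).

Lemma lift_signedE t x e : lift_signed t (x, e) = (t x, e).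
Proof. by rewrite permE. Qed.

Definition negl_fun (x : pt) : pt := (x.1, x.2 (+) (M < x.1)).
Lemma negl_funK : involutive negl_fun.
Proof. by move=> [x e]; rewrite /negl_fun /= -addbA addbb addbF. Qed.
Definition neg_last : {perm pt} := perm (inv_inj negl_funK).

Lemma neg_lastE x e : neg_last (x, e) = (x, e (+) (M < x)).
Proof. by rewrite permE. Qed.

(** [None] swaps the last two points and changes both signs. Writing it as a conjugate by [neg_last]
    lets it inherit relations from the last transposition. *)
Definition signed_gen (i : option 'I_M.+1) : {perm pt} :=
  match i with
  | Some i => lift_signed (tperm (inord i) (inord i.+1))
  | None => lift_signed (tperm (inord M) (inord M.+1)) ^ neg_last
  end.

Lemma lift_signedM t u : lift_signed (t * u) = lift_signed t * lift_signed u.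
Proof. by apply/permP => -[x e]; rewrite permM !lift_signedE permM. Qed.

Lemma lift_signed1 : lift_signed 1 = 1.
Proof. by apply/permP => -[x e]; rewrite lift_signedE !perm1. Qed.

Lemma lift_signedX t k : lift_signed (t ^+ k) = lift_signed t ^+ k.
Proof. by elim: k => [|k IH]; rewrite ?lift_signed1 // !expgS lift_signedM IH. Qed.

Lemma neg_last_sq : neg_last * neg_last = 1.
Proof. by apply/permP => x; rewrite permM !permE negl_funK. Qed.

Lemma signed_gen_None x e : signed_gen None (x, e) =
  (tperm (inord M) (inord M.+1) x, e (+) (M <= x)).
Proof.
have nV : neg_last^-1 = neg_last by apply/eqP; rewrite eq_invg_mul neg_last_sq.
rewrite /signed_gen conjgE nV !permM neg_lastE lift_signedE neg_lastE -addbA.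
congr (_, _ (+) _).
have xM := ltn_ord x; case: tpermP => [->|->|/eqP h1 /eqP h2].
- by rewrite !inordK //; lia.
- by rewrite !inordK //; lia.
rewrite -val_eqE /= inordK // in h1; rewrite -val_eqE /= inordK // in h2.
rewrite addbb; lia.
Qed.

Lemma tperm_disjoint (T : finType) (x y z t : T) :
  x != z -> x != t -> y != z -> y != t -> (tperm x y * tperm z t) ^+ 2 = 1.
Proof.
move=> xz xt yz yt; have c : commute (tperm x y) (tperm z t).
  rewrite /commute [RHS]conjgC tpermJ !tpermD // eq_sym //.
by rewrite expgMn // !expgS !expg0 !mulg1 !tperm2 mulg1.
Qed.

(** Conjugating either transposition by the other gives the same transposition [tperm x z], which is
    the braid relation. *)
Lemma tperm_braid (T : finType) (x y z : T) :
  x != y -> y != z -> x != z -> (tperm x y * tperm y z) ^+ 3 = 1.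
Proof.
move=> xy yz xz; rewrite !expgS expg0 mulg1.
set t := tperm x y; set u := tperm y z.
have : t ^ u = u ^ t.
  by rewrite !tpermJ tpermL tpermR ![tperm _ _ _]tpermD // eq_sym.
rewrite !conjgE !tpermV => e.
transitivity (t * (u * (t * u)) * (t * u)); first by rewrite !mulgA.
rewrite e !mulgA tperm2 mul1g -(mulgA u t t) tperm2 mulg1 tperm2 //.
Qed.

Lemma signed_gen_conj (i : 'I_M.+1) : i != M :> nat ->
  signed_gen (Some i) ^ neg_last = signed_gen (Some i).
Proof.
move=> iM; have nV : neg_last^-1 = neg_last by apply/eqP; rewrite eq_invg_mul neg_last_sq.
apply/permP => -[x e]; rewrite conjgE nV !permM neg_lastE lift_signedE neg_lastE.
have h : (M < tperm (inord i) (inord i.+1) x) = (M < x).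
  by have iM' := ltn_ord i; case: tpermP => [->|->|//]; rewrite !inordK //; lia.
by rewrite lift_signedE h -addbA addbb addbF.
Qed.

Lemma signed_gen_relations : coxeter_relations (@coxeter_mx_D M.+2) signed_gen.
Proof.
have SS (i j : 'I_M.+1) :
    (signed_gen (Some i) * signed_gen (Some j)) ^+ coxeter_mx_D (n := M.+2) (Some i) (Some j) = 1.
  rewrite /signed_gen -lift_signedM -lift_signedX -lift_signed1; congr lift_signed.
  have iM := ltn_ord i; have jM := ltn_ord j; rewrite /coxeter_mx_D.
  case: eqP => [->|/eqP]; first by rewrite expg1 tperm2.
  rewrite -val_eqE /= => ij; case: ifP => [/orP[/eqP E|/eqP E]|h].
  - by rewrite -E; apply: tperm_braid; rewrite -val_eqE /= !inordK //; lia.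
  - rewrite -E (tpermC (inord j.+1)) (tpermC (inord j)).
    by apply: tperm_braid; rewrite -val_eqE /= !inordK //; lia.
  by apply: tperm_disjoint; rewrite -val_eqE /= !inordK //; lia.
have gen0 : signed_gen None = signed_gen (Some ord_max) ^ neg_last by [].
have mx0 (i : 'I_M.+1) : i != M :> nat ->
    coxeter_mx_D (n := M.+2) (Some i) (Some ord_max) = coxeter_mx_D (n := M.+2) (Some i) None.
  move=> iM; have := ltn_ord i; rewrite /coxeter_mx_D -val_eqE /= (negPf iM) !eqSS => h.
  have -> : (M.+1 == i) = false by lia.
  by rewrite orbF.
have mx0' (i : 'I_M.+1) : i != M :> nat ->
    coxeter_mx_D (n := M.+2) (Some ord_max) (Some i) = coxeter_mx_D (n := M.+2) None (Some i).
  move=> iM; have := ltn_ord i; rewrite /coxeter_mx_D -val_eqE /= eq_sym (negPf iM) !eqSS => h.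
  by have -> : (M.+1 == i) = false by lia.
move=> [i|] [j|]; first exact: SS.
- have [iM|iM] := eqVneq (i : nat) M; last first.
    by rewrite gen0 -{1}(signed_gen_conj iM) -conjMg -conjXg -mx0 // SS conj1g.
  (* The two swaps of the last points cancel, leaving only their sign changes, which form an
     involution. This is the one pair that conjugation by [neg_last] does not settle. *)
  have E x e : (signed_gen (Some i) * signed_gen None) (x, e) =
      (x, e (+) (M <= tperm (inord M) (inord M.+1) x)).
    by rewrite permM lift_signedE signed_gen_None iM tpermK.
  rewrite /coxeter_mx_D iM eqSS (gtn_eqF (ltnSn _)); apply/permP => -[x e].
  by rewrite expgS expg1 permM !E perm1 -addbA addbb addbF.
- have [jM|jM] := eqVneq (j : nat) M; last first.
    by rewrite gen0 -{1}(signed_gen_conj jM) -conjMg -conjXg -mx0' // SS conj1g.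
  have E x e : (signed_gen None * signed_gen (Some j)) (x, e) = (x, e (+) (M <= x)).
    by rewrite permM signed_gen_None lift_signedE jM tpermK.
  rewrite /coxeter_mx_D jM eqSS (gtn_eqF (ltnSn _)); apply/permP => -[x e].
  by rewrite expgS expg1 permM !E perm1 -addbA addbb addbF.
by rewrite gen0 -conjMg expg1 -lift_signedM tperm2 lift_signed1 conj1g.
Qed.

Lemma signed_gen_inj : injective signed_gen.
Proof.
have NS (i : 'I_M.+1) : signed_gen None <> signed_gen (Some i).
  move=> /permP/(_ (inord M, false)); rewrite signed_gen_None lift_signedE => -[_].
  by rewrite inordK // leqnn.
move=> [i|] [j|] // => [/permP/(_ (inord i, false))|/esym/NS|/NS] //.
have iM := ltn_ord i; have jM := ltn_ord j.
rewrite !lift_signedE tpermL => -[] /(congr1 val).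
case: tpermP => [/(congr1 val)|/(congr1 val)|_ _]; rewrite /= !inordK //= 1?ltnW // => *.
- by congr Some; apply: val_inj.
- lia.
- lia.
Qed.

End SignedPermutations.

(** * Independent sets of the Coxeter graph *)

Section IndependentSets.
Variables (T : finType) (adj : rel T).
Hypotheses (adj_sym : symmetric adj) (adj_irr : irreflexive adj).

Definition independent (X : {set T}) := [forall x in X, forall y in X, ~~ adj x y].

Definition n_indep (U : {set T}) k :=
  #|[set X : {set T} | [&& X \subset U, independent X & #|X| == k]]|.

Lemma independentP (X : {set T}) :
  reflect {in X &, forall x y, ~~ adj x y} (independent X).
Proof.
apply: (iffP forall_inP) => [h x y xX yX|h x xX]; first by have /forall_inP := h x xX; apply.
by apply/forall_inP => y; apply: h.
Qed.

Lemma n_indep0 U : n_indep U 0 = 1.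
Proof.
rewrite /n_indep -(cards1 (set0 : {set T})); apply: eq_card => X.
rewrite !inE cards_eq0; case: eqP => [->|_]; rewrite ?andbF // sub0set /= andbT.
by apply/independentP => x y; rewrite inE.
Qed.

Lemma n_indep_set0 k : n_indep set0 k.+1 = 0.
Proof.
apply/eqP; rewrite cards_eq0; apply/eqP/setP => X; rewrite !inE subset0.
by case: eqP => // ->; rewrite cards0 andbF.
Qed.

(** Independent sets either avoid [v] or, after removal of [v], live on its non-neighbours. *)
Lemma n_indep_rec (U : {set T}) v k : v \in U ->
  n_indep U k.+1 = n_indep (U :\ v) k.+1 + n_indep [set x in U :\ v | ~~ adj v x] k.
Proof.
move=> vU; rewrite /n_indep -[LHS](cardsID [set X : {set T} | v \in X]) addnC; congr (_ + _).
  apply: eq_card => X; rewrite !inE subsetD1 andbC.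
  by case: (v \in X); rewrite ?andbF //= ?andbT.
rewrite -(card_in_imset (f := fun X : {set T} => X :\ v)); last first.
  move=> X Y; rewrite !inE => /andP[_ vX] /andP[_ vY] E.
  by rewrite -(setD1K vX) E setD1K.
apply: eq_card => Y; apply/imsetP/idP => [[X + ->]|].
  rewrite !inE => /andP[/and3P[/subsetP XU /independentP iX cX] vX].
  rewrite (cardsD1 v) vX eqSS in cX; rewrite cX andbT; apply/andP; split.
    apply/subsetP => x; rewrite !inE => /andP[-> xX]; rewrite XU //=; exact: iX.
  by apply/independentP => x y; rewrite !inE => /andP[_ xX] /andP[_ yX]; apply: iX.
rewrite inE => /and3P[/subsetP YU /independentP iY cY].
have vY : v \notin Y by apply/negP => /YU; rewrite !inE eqxx.
exists (v |: Y); last by rewrite setU1K.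
rewrite !inE eqxx cardsU1 vY add1n eqSS cY !andbT; apply/andP; split.
  by apply/subsetP => x; rewrite !inE => /orP[/eqP->//|/YU]; rewrite !inE => /andP[/andP[]].
apply/independentP => x y; rewrite !inE => /orP[/eqP->|xY] /orP[/eqP->|yY].
- by rewrite adj_irr.
- by have := YU _ yY; rewrite !inE => /andP[].
- by have := YU _ xY; rewrite !inE adj_sym => /andP[].
exact: iY.
Qed.

End IndependentSets.

(** * Order and commuting sets of generators in type D *)

Section TypeD.
Variables (M : nat) (W : finGroupType) (s : option 'I_M.+1 -> W).
Local Open Scope group_scope.
Local Notation mD := (@coxeter_mx_D M.+2).
Hypothesis hs : coxeter_system mD s.

Lemma coxeter_mx_D_diag x : mD x x = 1%N.
Proof. by case: x => [i|] //=; rewrite eqxx. Qed.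

Lemma coxeter_mx_D_sym x y : mD x y = mD y x.
Proof. by case: x y => [i|] [j|] //=; rewrite eq_sym orbC. Qed.

Let sK := gen_sq coxeter_mx_D_diag hs.
Let sV := gen_inv coxeter_mx_D_diag hs.

Lemma sD_rel x y : (s x * s y) ^+ mD x y = 1.
Proof. by case: hs. Qed.

Lemma sD_comm x y : mD x y = 2%N -> s x * s y = s y * s x.
Proof.
move=> h; have := sD_rel x y; rewrite h expgS expg1 => /eqP.
by rewrite -eq_invg_mul invMg !sV => /eqP.
Qed.

Lemma sD_braid x y : mD x y = 3 -> s x * s y * s x = s y * s x * s y.
Proof.
move=> h; have := sD_rel x y; rewrite h !expgS expg0 mulg1 => e.
apply/eqP; rewrite -[s x * s y * s x]invgK eq_invg_mul !invMg !sV.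
by rewrite -e !mulgA.
Qed.

Lemma sD_action : exists f : {multiplicative W -> {perm 'I_M.+2 * bool}},
  forall x, f (s x) = signed_gen x.
Proof. by case: hs => _ _ h; apply: h; apply: signed_gen_relations. Qed.

Lemma sD_inj : injective s.
Proof.
have [f fE] := sD_action => x y e.
by apply: signed_gen_inj; rewrite -!fE e.
Qed.

Lemma sD_commuteE x y : reflect (commute (s x) (s y)) (mD x y != 3).
Proof.
have [->|xy] := eqVneq x y; first by rewrite coxeter_mx_D_diag; left.
have [h|h] := eqVneq (mD x y) 3; constructor.
  (* Commutation would collapse the braid relation to [s x = s y]. *)
  move=> c; have := sD_braid h; rewrite c -mulgA sK mulg1 -c -mulgA sK mulg1.
  by move/sD_inj => e; rewrite e eqxx in xy.
apply: sD_comm; move: h xy; case: x y => [i|] [j|] //=; case: ifP => //.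
  by move/eqP => ->; rewrite eqxx.
by case: ifP.
Qed.

Lemma card_typeD : #|W| = (2 ^ M.+1 * M.+2`!)%N.
Proof.
pose a j := s (Some (inord j)); pose b := s None.
have inV j : j <= M -> (inord j : 'I_M.+1) = j :> nat by move=> jM; rewrite inordK.
have ne i j : i <= M -> j <= M -> i != j -> ((inord i : 'I_M.+1) == inord j) = false.
  by move=> iM jM ij; rewrite -val_eqE /= !inV //; apply: negPf.
have aK j : a j * a j = 1 by apply: sK.
have aC j k : j.+1 < k <= M -> a j * a k = a k * a j.
  move=> h; apply: sD_comm; rewrite /= ne; try lia.
  by rewrite !inV; try lia; rewrite ifF //; lia.
have aB j : j < M -> a j * a j.+1 * a j = a j.+1 * a j * a j.+1.
  move=> h; apply: sD_braid; rewrite /= ne; try lia.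
  by rewrite !inV ?eqxx //; lia.
have bC j : j <= M -> j.+1 != M -> a j * b = b * a j.
  by move=> h jM; apply: sD_comm; rewrite /= inV // !eqSS (negPf jM).
have bB j : j.+1 = M -> a j * b * a j = b * a j * b.
  by move=> h; apply: sD_braid; rewrite /= inV ?h ?eqxx // -h.
have [f fE] := sD_action.
have fa j x e : j <= M -> f (a j) (x, e) = (tperm (inord j) (inord j.+1) x, e).
  by move=> jM; rewrite fE lift_signedE inV.
have fb x e : f b (x, e) = (tperm (inord M) (inord M.+1) x, e (+) (M <= x)).
  by rewrite fE signed_gen_None.
have := card_tail_group aK (sK _) aC aB bC bB fa fb (leq0n _).
rewrite !subn0 => <-; rewrite -cardsT; congr #|pred_of_set _|.
case: hs => <- _ _; congr <<_>>; apply/setP => x; apply/imsetP/idP => [[[i|] _ ->]|].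
- rewrite inE; apply/orP; left; apply/imsetP; exists i; rewrite ?inE //.
  by rewrite /a inord_val.
- by rewrite !inE eqxx orbT.
case/tail_gensP => [[j _ ->]|[_ ->]]; [by exists (Some (inord j))|by exists None].
Qed.

Definition adjD : rel (option 'I_M.+1) := fun x y => mD x y == 3.

Lemma adjD_sym : symmetric adjD.
Proof. by move=> x y; rewrite /adjD coxeter_mx_D_sym. Qed.

Lemma adjD_irr : irreflexive adjD.
Proof. by move=> x; rewrite /adjD coxeter_mx_D_diag. Qed.

Lemma card_commuting_gensD k : #|commuting_gens s k| = n_indep adjD setT k.
Proof.
rewrite /n_indep -(card_imset _ (imset_inj sD_inj)); apply: eq_card => J.
rewrite inE; apply/idP/imsetP => [/and3P[JS /centsP cJ /eqP cardJ]|[X + ->]].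
  have EJ : J = s @: (s @^-1: J).
    apply/setP => x; apply/idP/imsetP => [xJ|[i + ->]]; last by rewrite inE.
    by have /imsetP[i _ e] := subsetP JS x xJ; exists i => //; rewrite inE -e.
  exists (s @^-1: J) => //; rewrite inE subsetT /=; apply/andP; split.
    apply/independentP => x y; rewrite !inE => xJ yJ; apply/sD_commuteE.
    exact: cJ.
  by rewrite -(card_imset _ sD_inj) -EJ cardJ.
rewrite inE => /and3P[_ /independentP iX cX]; rewrite card_imset ?cX ?andbT; last exact: sD_inj.
apply/andP; split; first by apply/subsetP => _ /imsetP[i _ ->]; apply: imset_f.
by apply/centsP => _ /imsetP[i iX' ->] _ /imsetP[j jX ->]; apply/sD_commuteE/iX.
Qed.

Definition initial_path m : {set option 'I_M.+1} :=
  [set x : option 'I_M.+1 | if x is Some i then i < m else false].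

Lemma n_indep_path m k : m <= M.+1 -> n_indep adjD (initial_path m) k = 'C(m.+1 - k, k).
Proof.
elim/ltn_ind: m k => m IH [|k] mM; first by rewrite n_indep0 bin0.
case: m => [|m] in IH mM *.
  have -> : initial_path 0 = set0 by apply/setP => -[i|]; rewrite !inE.
  by rewrite n_indep_set0 subSS sub0n.
rewrite (@n_indep_rec _ _ adjD_sym adjD_irr _ (Some (inord m))) ?inE ?inordK //.
have -> : initial_path m.+1 :\ Some (inord m) = initial_path m.
  apply/setP => -[i|]; rewrite !inE //.
  rewrite (inj_eq (@Some_inj _)) -val_eqE /= inordK //.
  by rewrite ltnS [RHS]ltn_neqAle.
(* Only vertex [m.-1] is a neighbour of [m] here; for [m = 0] the truncated predecessor still gives
   the empty path. *)
have -> : [set x in initial_path m | ~~ adjD (Some (inord m)) x] = initial_path m.-1.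
  apply/setP => -[i|]; rewrite !inE //= /adjD /= -val_eqE /= inordK //.
  by case: (eqVneq m i) => [<-|ne] /=; [lia|case: ifP => /= h; lia].
rewrite !IH; try lia.
case: m {IH} mM => [|m] mM /=; first by case: k => [|[|k]].
(* Pascal's rule applies in this range; beyond it truncated subtraction makes every upper index
   zero. *)
have [km|km] := leqP k m.+1; first by rewrite !subSS (subSn km) binS.
have -> : (m.+3 - k.+1 = 0)%N by lia.
have -> : (m.+2 - k.+1 = 0)%N by lia.
have -> : (m.+1 - k = 0)%N by lia.
by case: k km.
Qed.

Lemma binz_nat (x y : nat) : y <= x -> forall z, binz (x%:Z - y%:Z)%R (Posz z) = 'C(x - y, z).
Proof. by move=> yx z; rewrite subzn. Qed.

Lemma binz_neg (x y : nat) z : x < y -> binz (x%:Z - y%:Z)%R z = 0%N.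
Proof.
move=> xy; have -> : (x%:Z - y%:Z)%R = Negz (y - x.+1) by lia.
by [].
Qed.

(** The three terms count the sets containing both twin ends [None] and [Some ord_max], those
    containing [None] alone of the two, and those without [None]. Once [None] is chosen and its
    neighbour dropped, [Some ord_max] is isolated beside a path of [M.-1] vertices. *)
Lemma n_indepD k : n_indep adjD setT k =
  (binz (M.+2%:Z - k%:Z)%R (k%:Z - 2)%R + binz (M.+2%:Z - k%:Z - 1)%R (k%:Z - 1)%R
   + binz (M.+2%:Z - k%:Z)%R k%:Z)%N.
Proof.
have -> : (M.+2%:Z - k%:Z - 1 = M.+2%:Z - k.+1%:Z)%R by lia.
case: k => [|k].
  have -> : (0%:Z - 2 = Negz 1)%R by lia.
  have -> : (0%:Z - 1 = Negz 0)%R by lia.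
  by rewrite n_indep0 binz_nat //= bin0; case: (M.+2%:Z - 0)%R; case: (M.+2%:Z - 1)%R.
have -> : (k.+1%:Z - 1 = k%:Z)%R by lia.
rewrite (@n_indep_rec _ _ adjD_sym adjD_irr _ None) ?inE //.
have -> : setT :\ None = initial_path M.+1.
  by apply/setP => -[i|]; rewrite !inE //= ltn_ord.
rewrite n_indep_path //.
set V := [set x in _ | _].
have VS (i : 'I_M.+1) : (Some i \in V) = (i.+1 != M).
  by rewrite !inE /adjD /= ltn_ord !eqSS; case: ifP.
have V0 : (None \in V) = false by rewrite !inE.
case: k => [|k].
  have -> : (1%:Z - 2 = Negz 0)%R by lia.
  rewrite n_indep0 !binz_nat // subSS subn0 !bin1 bin0.
  by case: (M.+2%:Z - 1)%R => x /=; lia.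
have -> : (k.+2%:Z - 2 = k%:Z)%R by lia.
rewrite (@n_indep_rec _ _ adjD_sym adjD_irr _ (Some ord_max)); last by rewrite VS /=; lia.
have -> : V :\ Some ord_max = initial_path M.-1.
  apply/setP => -[i|]; last by rewrite in_setD1 V0 inE.
  rewrite in_setD1 VS inE (inj_eq (@Some_inj _)) -val_eqE /=.
  by have := ltn_ord i; lia.
have -> : [set x in initial_path M.-1 | ~~ adjD (Some ord_max) x] = initial_path M.-1.
  apply/setP => -[i|]; rewrite !inE // /adjD /= -val_eqE /=.
  have iM := ltn_ord i; case: (ltnP i M.-1) => //= h.
  by rewrite !ifF //; lia.
rewrite !n_indep_path; try lia.
(* For [k] above [M] the integer upper indices are negative and the truncated ones are zero with
   positive lower index, so both sides vanish. *)
have [kM|kM] := leqP k M; last first.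
  rewrite !binz_neg; try lia.
  have -> : (M.+2 - k.+2 = 0)%N by lia.
  have -> : (M.-1.+1 - k.+1 = 0)%N by lia.
  have -> : (M.-1.+1 - k = 0)%N by lia.
  by rewrite !bin0n; case: k kM.
rewrite !(@binz_nat M.+2 k.+2) // [LHS]addnC [X in X + _ = _]addnC !subSS.
congr (_ + _ + _)%N.
  (* At [M = 0] the number [M.-1.+1] is 1 instead of [M], but then [k = 0] and both binomials are
     1. *)
  have [M0|M0] := posnP M; last by rewrite prednK.
  by move: kM; rewrite M0 leqn0 => /eqP ->.
have [ltk|lek] := ltnP k M.
  by rewrite binz_nat // !subSS; congr 'C(_, _); lia.
(* Here [k = M], and the upper index of the middle term is -1. *)
rewrite binz_neg; last by lia.
by have -> : (M.-1 - k = 0)%N by lia.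
Qed.

End TypeD.

Import Order.TTheory GRing.Theory Num.Theory.
Local Open Scope ring_scope.

Theorem theorem3p15 (n k : nat) (W : finGroupType) (s : option 'I_n.-1 -> W)
    (hn : (2 <= n)%N) (hs : coxeter_system (@coxeter_mx_D n) s) :
  (#|boolean_intervals (right_weak s) k|%:R : rat) =
  (2%:R : rat) ^ (n%:Z - k%:Z - 1) * (n`!)%:R *
  (binz (n%:Z - k%:Z) (k%:Z - 2) + binz (n%:Z - k%:Z - 1) (k%:Z - 1)
   + binz (n%:Z - k%:Z) k%:Z)%N%:R.
Proof.
case: n s hn hs => [|[|M]] // s _ hs.
rewrite -n_indepD.
have [N [N_gen in_NM]] := inversion_cocycle (@coxeter_mx_D_diag M) hs.
have [hgen _ _] := hs; have hsq := gen_sq (@coxeter_mx_D_diag M) hs.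
(* The power of 2 in the statement can have a negative exponent, as for [n = k = 2], so the count is
   first made over the naturals with [2 ^ k] cleared. *)
have key : (#|boolean_intervals (right_weak s) k| * 2 ^ k =
            n_indep (@adjD M) setT k * (2 ^ M.+1 * M.+2`!))%N.
  rewrite (card_boolean_intervals hgen hsq N_gen in_NM).
  rewrite (card_min_coset_pairs N_gen in_NM).
  by rewrite (card_commuting_gensD hs) (card_typeD hs).
have u2 : (2%:R : rat) != 0 by [].
have pow2 : (2%:R : rat) ^ (M.+2%:Z - k%:Z - 1) * 2%:R ^+ k = 2%:R ^+ M.+1.
  by rewrite !exprnP -expfzDr //; congr (_ ^ _); lia.
apply: (mulIf (expf_neq0 k u2)); rewrite -natrX -natrM key !natrM !natrX -pow2.
by ring.
Qed.
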